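(* Let $\Gamma$ be a finitely generated abelian group equipped with an injective endomorphism $F$ such that, for every integer $\delta>0$, $F^{\delta}-1$ is not a zero divisor in the subring of $\operatorname{End}(\Gamma)$ generated by $F$. Suppose moreover that there exists an $F^r$-spanning set for $\Gamma$ for some integer $r>0$. Then every $F$-subset of $\Gamma$ is $F$-automatic.
   Context: Let $\Gamma$ be a finitely generated abelian group and $F$ an endomorphism of $\Gamma$. $F$-subsets: an $F$-subset of $\Gamma$ is a finite union of finite set sums ($A+B=\{a+b: a\in A,b\in B\}$) of: singletons in $\Gamma$; $F$-invariant subgroups $H\le\Gamma$ (i.e. $F(H)\subseteq H$); and $F$-cycles, i.e. sets $C(\gamma;\delta):=\{\gamma+F^\delta\gamma+F^{2\delta}\gamma+\cdots+F^{\ell\delta}\gamma:\ell\in\mathbb N\}$ with $\gamma\in\Gamma$, $\delta$ a positive integer ($0\in\mathbb N$). $F$-spanning sets: for a finite word $x_0x_1\cdots x_m$ with letters in $\Gamma$ put $[x_0x_1\cdots x_m]_F:=x_0+Fx_1+\cdots+F^mx_m$, and $[\emptyset]_F:=0$ for the empty word. A finite subset $\Sigma\subseteq\Gamma$ is an $F$-spanning set for $\Gamma$ if: (i) $0\in\Sigma$ and $x\in\Sigma\Rightarrow -x\in\Sigma$; (ii) for $x\in\Gamma$, $Fx\in\Sigma\Rightarrow x\in\Sigma$; (iii) every $x\in\Gamma$ equals $[x_0\cdots x_m]_F$ for some $m\ge 0$ and $x_0,\dots,x_m\in\Sigma$; (iv) for all $x_1,\dots,x_5\in\Sigma$ there are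 $t,t'\in\Sigma$ with $x_1+\cdots+x_5=t+Ft'$; (v) if $x_1,x_2,x_3\in\Sigma$ and $x_1+x_2+x_3\in F(\Gamma)$ then there is $t\in\Sigma$ with $x_1+x_2+x_3=Ft$. The notions of $F^r$-spanning set and $[w]_{F^r}$ are obtained by replacing $F$ by $F^r$. $F$-automaticity: let $\Sigma^*$ denote the set of finite words on $\Sigma$. If $\Sigma$ is an $F^r$-spanning set, $S\subseteq\Gamma$ is $(\Sigma,F^r)$-automatic if $\{w\in\Sigma^*:[w]_{F^r}\in S\}$ is a regular language (accepted by a finite automaton reading left to right). When $\Gamma$ admits an $F^r$-spanning set for some $r>0$, $S\subseteq\Gamma$ is $F$-automatic if $S$ is $(\Sigma,F^r)$-automatic for some $r>0$ and some $F^r$-spanning set $\Sigma$. *)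

(* Defs.v *)
From HB Require Import structures.
From mathcomp Require Import all_boot all_algebra.
From mathcomp Require Import finmap.
From mathcomp Require Import boolp classical_sets.

Set Implicit Arguments.
Unset Strict Implicit.
Unset Printing Implicit Defensive.

Import GRing.Theory.

Local Open Scope classical_set_scope.
Local Open Scope ring_scope.

Record dfa (A : finType) := Dfa {
  dfa_state : finType;
  dfa_start : dfa_state;
  dfa_final : {set dfa_state};
  dfa_trans : dfa_state -> A -> dfa_state }.

Definition dfa_accept (A : finType) (M : dfa A) (w : seq A) : bool :=
  foldl (@dfa_trans A M) (dfa_start M) w \in dfa_final M.

Definition regular (A : finType) (L : set (seq A)) : Prop :=
  exists M : dfa A, L = [set w | dfa_accept M w].

Definition finitely_generated (G : zmodType) : Prop :=
  exists s : seq G, forall x : G,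
    exists c : 'I_(size s) -> int, x = \sum_(i < size s) s`_i *~ c i.

Section Endomorphisms.
Variable G : zmodType.
Implicit Types (F f g a b : G -> G).

                                                                          
                                                                          
Inductive subring_gen F : (G -> G) -> Prop :=
| subring_gen_base : subring_gen F F
| subring_gen_one : subring_gen F id
| subring_gen_sub f g : subring_gen F f -> subring_gen F g ->
    subring_gen F (fun x => f x - g x)
| subring_gen_mul f g : subring_gen F f -> subring_gen F g ->
    subring_gen F (f \o g).

                                                       
Definition zero_divisor (R : (G -> G) -> Prop) a : Prop :=
  exists b, [/\ R b, ~ (b =1 fun=> 0)
              & (a \o b =1 fun=> 0) \/ (b \o a =1 fun=> 0)].

End Endomorphisms.

Section FSubsets.
Variables (G : zmodType) (F : G -> G).

Definition subgroup (H : set G) : Prop :=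
  H 0 /\ forall x y, H x -> H y -> H (x - y).

Definition Fcycle (g : G) (d : nat) : set G :=
  [set x | exists l : nat, x = \sum_(i < l.+1) iter (i * d) F g].

Inductive Fbasic : set G -> Prop :=
| Fbasic_point (g : G) : Fbasic [set g]
| Fbasic_subgroup (H : set G) :
    subgroup H -> (forall x, H x -> H (F x)) -> Fbasic H
| Fbasic_cycle (g : G) (d : nat) : (0 < d)%N -> Fbasic (Fcycle g d).

Definition sumset (A B : set G) : set G := [set a + b | a in A & b in B].

                                                                               
Definition Fsubset (S : set G) : Prop :=
  exists (m : nat) (n : nat -> nat) (A : nat -> nat -> set G),
    (forall i j, (i < m)%N -> (j < n i)%N -> Fbasic (A i j)) /\
    S = \big[setU/set0]_(i < m) \big[sumset/[set 0]]_(j < n i) A i j.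

Definition bracket (w : seq G) : G := \sum_(i < size w) iter i F w`_i.

Definition spanning_set (Sigma : {fset G}) : Prop :=
  [/\ 0 \in Sigma /\ (forall x, x \in Sigma -> - x \in Sigma),
      forall x, F x \in Sigma -> x \in Sigma,
      forall x, exists w : seq Sigma,
        w <> [::] /\ x = bracket [seq val y | y <- w],
      forall x1 x2 x3 x4 x5,
        x1 \in Sigma -> x2 \in Sigma -> x3 \in Sigma ->
        x4 \in Sigma -> x5 \in Sigma ->
        exists t t', [/\ t \in Sigma, t' \in Sigma
                       & x1 + x2 + x3 + x4 + x5 = t + F t']
    & forall x1 x2 x3,
        x1 \in Sigma -> x2 \in Sigma -> x3 \in Sigma ->
        (exists y, x1 + x2 + x3 = F y) ->
        exists2 t, t \in Sigma & x1 + x2 + x3 = F t].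

Definition automatic_over (Sigma : {fset G}) (S : set G) : Prop :=
  regular [set w : seq Sigma | S (bracket [seq val y | y <- w])].

End FSubsets.

Definition Fautomatic (G : zmodType) (F : G -> G) (S : set G) : Prop :=
  exists (r : nat) (Sigma : {fset G}),
    [/\ (0 < r)%N, spanning_set (iter r F) Sigma
      & automatic_over (iter r F) Sigma S].

(* Main.v *)
Require Import Defs.
From HB Require Import structures.
From mathcomp Require Import all_boot all_algebra.
From mathcomp Require Import finmap boolp classical_sets.

Set Implicit Arguments.
Unset Strict Implicit.
Unset Printing Implicit Defensive.

Import GRing.Theory.

Local Open Scope classical_set_scope.
Local Open Scope ring_scope.

(** Write [Phi] for the power of [F] for which digits are given, and [Sigma] for
    the digits. An automaton reading a word from its least significant digit
    moves, on the digit [x], from the task of deciding membership in [S] to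
    that of deciding membership in the quotient [{y | x + Phi y \in S}]. So [S]
    is automatic as soon as it belongs to a finite family of sets whose
    quotients by digits are unions of members of the family
    ([recognized_automatic]).

    Such families come from bounded carries ([absorb]): for each finite set [A]
    there is a finite set [B] containing [0] such that [b + a = Phi y] with [b]
    in [B] and [a] in [A] forces [y] to lie in [B]. The reason is that a sum of
    [5 n] digits is a sum of [n] digits plus [Phi] of a sum of [n] digits, so
    that dividing by [Phi] contracts long sums.

    All the building blocks of an [F]-subset satisfy an equation
    [S = P `|` (Q + Phi^d S)] with [P] and [Q] finite and [d > 0]. For a point
    one takes [Q] empty. A cycle is a finite set of short partial sums together
    with a translate of its own image. For an invariant subgroup [H], the set
    [P] is empty and [Q] represents the cosets of [Phi H] in [H]: there are
    finitely many because, by Cayley-Hamilton and injectivity, [Phi] satisfies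
    an integer polynomial with nonzero constant term [a], so that [Phi H]
    contains [a H], which has finite index ([finite_cokernel]). Such an equation
    makes the translates [b + Phi^j S], with [j < d] and [b] in an absorbing
    set, together with the points [b], a family as above
    ([recognized_self_similar]).

    Finally recognized sets are closed under union, and under sums because the
    carries of an addition are bounded as well ([recognized_sumset]). *)

(** * From finite families of quotients to automata *)

Section Kernels.
Variables (G : zmodType) (Phi : {additive G -> G}) (Sigma : {fset G}).

Lemma bracket_cons x w : bracket Phi (x :: w) = x + Phi (bracket Phi w).
Proof. by rewrite /bracket big_ord_recl /= raddf_sum. Qed.

Lemma bracket_nil : bracket Phi [::] = 0.
Proof. by rewrite /bracket big_ord0. Qed.

(** Each quotient of a member of the family by a digit is the union of the
    members that it contains. Spelling this out pointwise keeps the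
    nondeterminism implicit: no set of successors has to be chosen. *)
Definition quotient_closed (I : Type) (f : I -> set G) : Prop :=
  forall i x y, x \in Sigma -> f i (x + Phi y) ->
    exists2 j, f j y & forall z, f j z -> f i (x + Phi z).

Definition recognized (S : set G) : Prop :=
  exists (I : finType) (f : I -> set G),
    quotient_closed f /\ forall y, S y -> exists2 j, f j y & f j `<=` S.

(** Subset construction: a set [J] of indices stands for the union of the [f j]
    over [J]. Reading [x], one moves to all indices whose set lies in the
    quotient by [x] of some [f i] with [i] in [J]. *)
Lemma recognized_automatic S : recognized S -> automatic_over Phi Sigma S.
Proof.
move=> [I [f [fclosed fS]]].
pose step (J : {set I}) (x : Sigma) : {set I} :=
  [set j | [exists i in J, `[< forall z, f j z -> f i (val x + Phi z) >]]]%SET.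
pose M := @Dfa Sigma {set I} [set j | `[< f j `<=` S >]]%SET
  [set J : {set I} | [exists j in J, `[< f j 0 >]]]%SET step.
have runP w : forall J : {set I}, (foldl step J w \in dfa_final M) <->
    exists2 j, j \in J & f j (bracket Phi [seq val y | y <- w]).
  elim: w => [|x w IHw] J /=.
    rewrite inE bracket_nil; split.
      by case/exists_inP=> j Jj /asboolP fj0; exists j.
    by case=> j Jj fj0; apply/exists_inP; exists j => //; apply/asboolP.
  rewrite bracket_cons; split.
    move/IHw=> [j]; rewrite inE => /exists_inP[i Ji /asboolP sub] fj.
    by exists i => //; apply: sub.
  case=> i Ji /(fclosed _ _ _ (valP x))[j fj sub].
  apply/IHw; exists j => //; rewrite inE.
  by apply/exists_inP; exists i => //; apply/asboolP.
exists M; apply/seteqP; split => w /=; rewrite /dfa_accept /=.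
  move=> /fS[j fj sub]; apply/runP; exists j => //.
  by rewrite inE; apply/asboolP.
by move/runP=> [j]; rewrite inE => /asboolP; apply.
Qed.

Lemma recognized0 : recognized set0.
Proof. by exists void, (fun=> set0); split=> [[]|]. Qed.

Lemma recognizedU A B : recognized A -> recognized B -> recognized (A `|` B).
Proof.
move=> [I [f [fcl fA]]] [J [g [gcl gB]]].
exists (I + J)%type, (fun k => match k with inl i => f i | inr j => g j end).
split.
  move=> [i|j] x y xS.
    by move/(fcl _ _ _ xS)=> [k fk sub]; exists (inl k).
  by move/(gcl _ _ _ xS)=> [k fk sub]; exists (inr k).
move=> y [/fA[i fi sub]|/gB[j gj sub]].
  by exists (inl i) => // z /sub; left.
by exists (inr j) => // z /sub; right.
Qed.

(** * Bounded carries *)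

Hypotheses (Phi_inj : injective Phi) (span : spanning_set Phi Sigma).

Let mem0 : 0 \in Sigma. Proof. by case: span => -[]. Qed.

Lemma digit_split x : exists2 t, t \in Sigma & exists y, x = t + Phi y.
Proof.
case: span => _ _ spanw _ _; have [[|t w] [// _ ->]] := spanw x.
exists (val t); first exact: valP.
by exists (bracket Phi (map val w)); rewrite /= bracket_cons.
Qed.

Definition sums (n : nat) : seq G :=
  iter n (fun s => [seq a + b | a <- Sigma, b <- s]) [:: 0].

Lemma sumsS n x :
  reflect (exists a b, [/\ a \in Sigma, b \in sums n & x = a + b])
          (x \in sums n.+1).
Proof.
apply: (iffP allpairsP) => [[[a b] /= [? ? ->]]|[a [b [? ? ->]]]].
  by exists a, b.
by exists (a, b).
Qed.

Lemma sumsD m n x y : x \in sums m -> y \in sums n -> x + y \in sums (m + n).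
Proof.
elim: m x => [|m IHm] x; first by rewrite inE => /eqP ->; rewrite add0r.
case/sumsS=> a [b [aS bS ->]] yS; apply/sumsS; exists a, (b + y).
by split; rewrite ?addrA ?IHm.
Qed.

Lemma sums0 n : 0 \in sums n.
Proof.
elim: n => [|n IHn]; first by rewrite inE.
by apply/sumsS; exists 0, 0; rewrite addr0.
Qed.

(** Adding two digits gives [t + Phi t'], which trades one summand for a carry.
    After [n - 1] such steps a single digit divisible by [Phi] remains, and its
    preimage is a digit. *)
Lemma sums_Phi n x : Phi x \in sums n -> x \in sums n.
Proof.
have sums1 s : s \in Sigma -> s \in sums 1.
  by move=> sS; apply/sumsS; exists s, 0; rewrite addr0 inE.
case: n => [|n]; first by rewrite !inE -[0](raddf0 Phi) (inj_eq Phi_inj) raddf0.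
elim: n x => [|n IHn] x /sumsS[a [b [aS bS e]]].
  move: bS e; rewrite inE => /eqP ->; rewrite addr0 => e; apply: sums1.
  by case: span => _ S2 _ _ _; apply: S2; rewrite e.
have /sumsS[a' [c [a'S cS eb]]] := bS.
case: span => _ _ _ S4 _.
have [t [t' [tS t'S et]]] := S4 _ _ _ _ _ aS a'S mem0 mem0 mem0.
have xt : x - t' \in sums n.+1.
  apply: IHn; rewrite raddfB e eb addrA.
  rewrite !addr0 in et; rewrite et addrAC addrK.
  by apply/sumsS; exists t, c.
by rewrite -(subrK t' x) -addn1; apply: sumsD => //; apply: sums1.
Qed.

Lemma sums_carry n x : x \in sums (5 * n) ->
  exists u v, [/\ u \in sums n, v \in sums n & x = u + Phi v].
Proof.
elim: n x => [|n IHn] x.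
  by rewrite muln0 inE => /eqP ->; exists 0, 0; rewrite !inE raddf0 addr0.
rewrite mulnS; case/sumsS=> a1 [_ [S1 /sumsS[a2 [_ [S2 /sumsS[a3 [_ [S3
  /sumsS[a4 [_ [S4 /sumsS[a5 [y [S5 yS ->]]] ->]]] ->]]] ->]]] ->]].
have [u [v [uS vS ->]]] := IHn _ yS.
case: span => _ _ _ Q _; have [t [t' [tS t'S e]]] := Q _ _ _ _ _ S1 S2 S3 S4 S5.
exists (t + u), (t' + v); split.
- by apply/sumsS; exists t, u.
- by apply/sumsS; exists t', v.
by rewrite !addrA e raddfD !addrA; congr (_ + _); rewrite addrAC.
Qed.

(** There are [3 n <= 5 n] digits in [b + a]. By [sums_carry] this is
    [u + Phi v] with [u] and [v] in [sums n]; then [u] is divisible by [Phi] and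
    contributes [n] digits to [y], besides the [n] digits of [v]. *)
Lemma absorb_sums n b a y :
  b \in sums (n + n) -> a \in sums n -> b + a = Phi y -> y \in sums (n + n).
Proof.
move=> bS aS e.
have : b + a + 0 \in sums (5 * n).
  rewrite (_ : (5 * n = n + n + n + (n + n))%N); last by rewrite !mulSn addn0 !addnA.
  by apply: sumsD (sums0 _); apply: sumsD.
rewrite addr0 => /sums_carry[u [v [uS vS]]]; rewrite e => e'.
rewrite -(subrK v y); apply: sumsD => //; apply: sums_Phi.
by rewrite raddfB e' addrK.
Qed.

Definition words (m : nat) : seq G :=
  iter m (fun s => [seq x + Phi y | x <- Sigma, y <- s]) [:: 0].

Lemma wordsS m x :
  reflect (exists a b, [/\ a \in Sigma, b \in words m & x = a + Phi b])
          (x \in words m.+1).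
Proof.
apply: (iffP allpairsP) => [[[a b] /= [? ? ->]]|[a [b [? ? ->]]]].
  by exists a, b.
by exists (a, b).
Qed.

Lemma words0 m : 0 \in words m.
Proof.
elim: m => [|m IHm]; first by rewrite inE.
by apply/wordsS; exists 0, 0; rewrite raddf0 addr0.
Qed.

Lemma words_le m n x : (m <= n)%N -> x \in words m -> x \in words n.
Proof.
elim: n m x => [|n IHn] [|m] x //; first by rewrite inE => _ /eqP ->; apply: words0.
move=> le_mn /wordsS[a [b [aS bS ->]]].
by apply/wordsS; exists a, b; split=> //; apply: IHn bS.
Qed.

Lemma words_exhaust (A : seq G) : exists m, {subset A <= words m}.
Proof.
elim: A => [|x A [m Am]]; first by exists 0%N.
have [n xn] : exists n, x \in words n.
  case: span => _ _ /(_ x)[w [_ ->]] _ _; exists (size w).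
  elim: w => [|t w IHw] /=; first by rewrite bracket_nil inE.
  rewrite bracket_cons; apply/wordsS.
  by exists (val t), (bracket Phi (map val w)); split=> //; apply: valP.
exists (maxn m n) => z; rewrite inE => /predU1P[->|/Am zm].
  by apply: words_le xn; apply: leq_maxr.
by apply: words_le zm; apply: leq_maxl.
Qed.

(** To absorb a word [t + Phi a], defer its tail: the set [B + words m] absorbs
    it, since [a] becomes part of the carry at the next step. The digit [t] joins
    the sum [s], which is why [n] has to be arbitrary in the induction on [m]. *)
Lemma absorb_words m n : exists2 B : seq G, 0 \in B &
  forall b s a y, b \in B -> s \in sums n -> a \in words m ->
    b + s + a = Phi y -> y \in B.
Proof.
elim: m n => [|m IHm] n.
  exists (sums (n + n)); first exact: sums0.
  move=> b s a y bB sn; rewrite inE => /eqP ->; rewrite addr0.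
  exact: absorb_sums.
have [B B0 Babs] := IHm n.+1.
exists [seq b + a | b <- B, a <- words m].
  by apply/allpairsP; exists (0, 0); rewrite /= addr0 words0.
move=> _ s _ y /allpairsP[[b a'] /= [bB a'm ->]] sn /wordsS[t [a [tS am ->]]] e.
apply/allpairsP; exists (y - a, a) => /=; split=> //; last by rewrite subrK.
apply: (Babs b (t + s) a') => //; first by apply/sumsS; exists t, s.
rewrite raddfB -e !addrA addrK -!addrA; congr (_ + _).
by rewrite addrC -addrA addrCA addrA.
Qed.

(** Padding by the digit [0] makes [words m] increase with [m] to all of [G], so
    a finite set lies in one of them. *)
Lemma absorb (A : seq G) : exists2 B : seq G, 0 \in B &
  forall b a y, b \in B -> a \in A -> b + a = Phi y -> y \in B.
Proof.
have [m Am] := words_exhaust A; have [B B0 Babs] := absorb_words m 0.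
exists B => // b a y bB /Am am e; apply: (Babs b 0 a) => //; last by rewrite addr0.
exact: sums0.
Qed.

(** * Sums and self-similar sets *)

(** Schoolbook addition: the family consists of the [c + (f i + g j)], with [c] a
    carry. The increments that have to be absorbed are the [s + t - x], where
    [s] and [t] are digits of the two summands and [x] is a digit of the sum. *)
Lemma recognized_sumset A B :
  recognized A -> recognized B -> recognized (sumset A B).
Proof.
move=> [I [f [fcl fA]]] [J [g [gcl gB]]].
have [D D0 Dabs] := absorb [seq x + z | x <- [seq s + t | s <- Sigma, t <- Sigma],
                                       z <- [seq - s | s <- Sigma]].
pose h (k : I * J * seq_sub D) : set G :=
  [set y | exists a b, [/\ f k.1.1 a, g k.1.2 b & y = ssval k.2 + (a + b)]].
exists (I * J * seq_sub D)%type, h; split.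
  move=> [[i j] [c cD]] x y xS [/= a [b /= [fa gb e]]].
  have [s sS [a' ea]] := digit_split a; have [t tS [b' eb]] := digit_split b.
  move: fa; rewrite ea => /(fcl _ _ _ sS)[i' fa' subf].
  move: gb; rewrite eb => /(gcl _ _ _ tS)[j' gb' subg].
  have ec : c + (s + t + - x) = Phi (y - (a' + b')).
    apply: (addrI x); rewrite raddfB raddfD [RHS]addrA e ea eb /=.
    by rewrite (addrACA s) [c + _ in RHS]addrA addrK [LHS]addrCA subrKC.
  have eD : y - (a' + b') \in D.
    apply: Dabs cD _ ec.
    apply/allpairsP; exists (s + t, - x) => /=; split=> //; last exact: map_f.
    by apply/allpairsP; exists (s, t).
  exists (i', j', SeqSub eD) => /=; first by exists a', b'; rewrite subrK.
  move=> z [a'' [b'' /= [fa'' gb'' ->]]].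
  exists (s + Phi a''), (t + Phi b''); split; [exact: subf|exact: subg|].
  rewrite raddfD -ec raddfD /= (addrACA s) [LHS]addrA.
  by rewrite [x + (c + _)]addrCA subrKC -addrA.
move=> _ [a /fA[i fi subf] [b /gB[j gj subg] <-]].
exists (i, j, SeqSub D0); first by exists a, b; rewrite /= add0r.
move=> _ [a' [b' /= [fa' gb' ->]]]; rewrite add0r.
by exists a'; [exact: subf|exists b'; [exact: subg|]].
Qed.

(** The state [(Some j, b)] stands for [b + Phi^j S] and [(None, b)] for the point
    [b]. A digit lowers [j]; at [j = 0] the equation for [S] unfolds once and
    either ends at a point of [P] or restarts at [j = d - 1]. *)
Lemma recognized_self_similar (P Q : seq G) d S : (0 < d)%N ->
  (forall y, S y <-> y \in P \/
     exists q z, [/\ q \in Q, S z & y = q + iter d Phi z]) ->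
  recognized S.
Proof.
case: d => // d _ SE.
have [B B0 Babs] := absorb [seq p - x | p <- 0 :: P ++ Q, x <- Sigma].
have stepB b p x y : b \in B -> p \in 0 :: P ++ Q -> x \in Sigma ->
    b + (p - x) = Phi y -> y \in B.
  move=> bB pPQ xS; apply: Babs => //.
  by apply/allpairsP; exists (p, x).
pose f (k : option 'I_d.+1 * seq_sub B) : set G :=
  if k.1 is Some j then [set y | exists2 z, S z & y = ssval k.2 + iter j Phi z]
  else [set ssval k.2].
exists (option 'I_d.+1 * seq_sub B)%type, f; split; last first.
  move=> y Sy; exists (Some ord0, SeqSub B0); rewrite /f /=.
    by exists y; rewrite ?add0r.
  by move=> _ [z Sz ->]; rewrite add0r.
move=> [[[[|j] ltj]|] [b bB]] x y xS; rewrite /f /=.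
(* The ordinal bound is the successor of this [d], so [ord_max] is [d] itself. *)
- move=> [z /SE[zP|[q [z' [qQ Sz' ez]]]] e].
    have yB : y \in B.
      apply: (stepB b z x) => //; first by rewrite inE mem_cat zP orbT.
      by rewrite addrA -e addrC addKr.
    exists (None, SeqSub yB) => //= _ ->.
    by exists z => //; apply/SE; left.
  have ec : b + (q - x) = Phi (y - iter d Phi z').
    apply: (addrI x); rewrite raddfB [RHS]addrA e ez /=.
    by rewrite [b + _ in RHS]addrA addrK [LHS]addrCA subrKC.
  have eB : y - iter d Phi z' \in B.
    by apply: stepB ec => //; rewrite inE mem_cat qQ !orbT.
  exists (Some ord_max, SeqSub eB) => /=; first by exists z'; rewrite ?subrK.
  move=> _ [z'' Sz'' ->]; exists (q + iter d.+1 Phi z'').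
    by apply/SE; right; exists q, z''.
  by rewrite raddfD -ec [LHS]addrA [x + (b + _)]addrCA subrKC -addrA.
- move=> [z Sz e].
  have ec : b + (0 - x) = Phi (y - iter j Phi z).
    by apply: (addrI x); rewrite raddfB [RHS]addrA e addrK add0r subrKC.
  have eB : y - iter j Phi z \in B by apply: stepB ec; rewrite ?inE ?eqxx.
  exists (Some (Ordinal (ltnW ltj)), SeqSub eB) => /=.
    by exists z; rewrite ?subrK.
  move=> _ [z' Sz' ->]; exists z' => //.
  by rewrite raddfD -ec add0r addrA subrKC.
move=> e; have yB : y \in B.
  apply: (stepB b 0 x) => //; first by rewrite inE eqxx.
  by rewrite add0r -e addrC addKr.
by exists (None, SeqSub yB) => //= _ ->.
Qed.

Lemma recognized_set1 g : recognized [set g].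
Proof.
apply: (@recognized_self_similar [:: g] [::] 1) => // y; split.
  by move=> ->; left; rewrite inE.
by case=> [|[q [z []]]] //; rewrite inE => /eqP.
Qed.

End Kernels.

(** * Finiteness of the cokernel on invariant subgroups *)

Section FiniteIndex.
Variable G : zmodType.

Section Subgroup.
Variable H : set G.
Hypothesis sgH : subgroup H.

Lemma subgroupN x : H x -> H (- x).
Proof. by move=> Hx; rewrite -sub0r; apply: sgH.2 => //; apply: sgH.1. Qed.

Lemma subgroupD x y : H x -> H y -> H (x + y).
Proof. by move=> Hx Hy; rewrite -[y]opprK; apply: sgH.2 => //; apply: subgroupN. Qed.

Lemma subgroupMz x n : H x -> H (x *~ n).
Proof.
move=> Hx; have Hn k : H (x *+ k).
  by elim: k => [|k IHk]; [exact: sgH.1|rewrite mulrS; apply: subgroupD].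
by case: n => n; [exact: Hn|apply: subgroupN; apply: Hn].
Qed.

End Subgroup.

(** The span of the entries of [s], in a form suited to induction on [s]: the
    coefficient of the head can be read off. *)
Fixpoint zspan (s : seq G) : set G :=
  if s is g :: s' then [set x | exists n : int, zspan s' (x - g *~ n)]
  else [set 0].

Lemma zspan_subgroup s : subgroup (zspan s).
Proof.
elim: s => [|g s [IH0 IHB]] /=; first by split=> // x y -> ->; rewrite subr0.
split; first by exists 0; rewrite mulr0z subr0.
move=> x y [m xm] [n yn]; exists (m - n).
have -> : x - y - g *~ (m - n) = x - g *~ m - (y - g *~ n).
  by rewrite mulrzBr !opprB [RHS]addrACA [- (g *~ m) - y]addrC addrACA.
exact: IHB.
Qed.

Lemma zspan_sum s (c : 'I_(size s) -> int) :
  zspan s (\sum_(i < size s) s`_i *~ c i).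
Proof.
elim: s c => [|g s IHs] c /=; first by rewrite big_ord0.
exists (c ord0); rewrite big_ord_recl /= addrC addKr; exact: IHs.
Qed.

(** Subgroups of finitely generated abelian groups are finitely generated, in the
    form needed here. If some element of [H] has a nonzero coefficient at the
    first generator [g], then an element [k] of [H] with the least positive such
    coefficient generates [H] together with the intersection of [H] and the span
    of the other generators. *)
Lemma subgroup_mod_finite s (H : set G) (N : int) : N != 0 ->
  subgroup H -> H `<=` zspan s ->
  exists P : seq G, [/\ forall p, p \in P -> H p &
    forall h, H h -> exists p h', [/\ p \in P, H h' & h = p + h' *~ N]].
Proof.
move=> N0; elim: s H => [|g s IHs] H sgH Hs.
  exists [:: 0]; split=> [p|h /Hs ->]; first by rewrite inE => /eqP ->; apply: sgH.1.
  by exists 0, 0; rewrite inE mul0rz addr0; split=> //; apply: sgH.1.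
have sgs := zspan_subgroup s.
pose H' : set G := H `&` zspan s.
have sgH' : subgroup H'.
  split; first by split; [exact: sgH.1|exact: sgs.1].
  by move=> x y [Hx sx] [Hy sy]; split; [exact: sgH.2|exact: sgs.2].
have [P [PH Pcov]] := IHs H' sgH' (@subIsetr _ _ _).
(* [lead n] is about the coefficient [n.+1], so that [ex_minn] only ranges over
   positive coefficients. *)
pose lead n := `[< exists2 h, H h & zspan s (h - g *~ (n.+1 : int)) >].
case: (pselect (exists n, lead n)) => [exn|nolead]; last first.
  have HH' h : H h -> zspan s h.
    move=> Hh; have [[[|n]|n] hn] := Hs h Hh.
    - by rewrite mulr0z subr0 in hn.
    - by case: nolead; exists n; apply/asboolP; exists h.
    case: nolead; exists n; apply/asboolP; exists (- h); first exact: subgroupN.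
    have -> : - h - g *~ (n.+1 : int) = - (h - g *~ Negz n).
      by rewrite NegzE mulrNz opprK opprD.
    exact: subgroupN.
  exists P; split=> [p /PH[]//|h Hh].
  by have [p [h' [pP [Hh' _] e]]] := Pcov h (conj Hh (HH' h Hh)); exists p, h'.
case: (ex_minnP exn) => d /asboolP[k Hk kd] dmin.
(* Divide the coefficient of [h] by [d.+1]: a nonzero remainder would contradict
   the minimality of [d]. *)
have dvd h : H h -> exists q : int, H' (h - k *~ q).
  move=> Hh; have [n hn] := Hs h Hh; exists (n %/ (d.+1 : int))%Z.
  have Hr : H (h - k *~ (n %/ (d.+1 : int))%Z).
    by apply: sgH.2 => //; apply: subgroupMz.
  split=> //.
  have sr : zspan s (h - k *~ (n %/ (d.+1 : int))%Z - g *~ (n %% (d.+1 : int))%Z).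
    have := sgs.2 _ _ hn (subgroupMz sgs (n %/ (d.+1 : int))%Z kd).
    rewrite mulrzBl -mulrzA [(d.+1 : int) * _]mulrC {1}(divz_eq n d.+1) mulrzDr.
    by rewrite [_ *~ _ + _]addrC opprD addrA opprB subrKA addrAC.
  case E: (n %% (d.+1 : int))%Z sr => [[|r]|r] sr.
  - by rewrite mulr0z subr0 in sr.
  - have /dmin : lead r by apply/asboolP; exists (h - k *~ (n %/ (d.+1 : int))%Z).
    have := ltz_mod n (isT : (d.+1 : int) != 0).
    by rewrite E ltz_nat absz_nat ltnS ltnNge => /negbTE->.
  by have := modz_ge0 n (isT : (d.+1 : int) != 0); rewrite E.
exists [seq k *~ Posz r + p | r <- iota 0 `|N|%N, p <- P]; split.
  move=> _ /allpairsP[[r p] /= [_ /PH[Hp _] ->]].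
  by apply: subgroupD => //; apply: subgroupMz.
move=> h Hh; have [q /Pcov[p [h' [pP [Hh' _] e]]]] := dvd h Hh.
have [r er] : exists r : nat, (q %% N)%Z = r.
  by have := modz_ge0 q N0; case: (q %% N)%Z => // r _; exists r.
exists (k *~ (r : int) + p), (h' + k *~ (q %/ N)%Z); split.
- apply/allpairsP; exists (r, p); split=> //=; rewrite mem_iota /=.
  by have := ltz_mod q N0; rewrite er.
- by apply: subgroupD => //; apply: subgroupMz.
rewrite -(subrK (k *~ q) h) e {1}(divz_eq q N) er mulrzDr mulrzDl -mulrzA.
by rewrite [_ *~ (_ * _) + _ *~ r]addrC addrACA [p + _]addrC.
Qed.

Variable Phi : {additive G -> G}.
Hypotheses (Phi_inj : injective Phi) (fgG : finitely_generated G).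

(** The action of an integer polynomial in [Phi], in Horner form: it makes the
    constant coefficient and divisibility by [Phi] visible. *)
Fixpoint poly_act (c : seq int) (x : G) : G :=
  if c is a :: c' then x *~ a + Phi (poly_act c' x) else 0.

Lemma poly_act_sum c x :
  poly_act c x = \sum_(k < size c) iter k Phi x *~ c`_k.
Proof.
elim: c => [|a c IHc] /=; first by rewrite big_ord0.
rewrite big_ord_recl IHc raddf_sum /=; congr (_ + _).
by apply: eq_bigr => k _; rewrite raddfMz.
Qed.

(** The matrix [A] of [Phi] on a generating family need not be unique, but any
    integer polynomial killing [A] kills [Phi]. *)
Lemma monic_annihilator :
  exists2 p : {poly int}, p \is monic & forall x, poly_act p x = 0.
Proof.
have [s sgen] := fgG.
(* A zero generator is added so that matrices have positive size. *)
pose n := size s; pose e (i : 'I_n.+1) := (0 :: s)`_i.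
have egen x : exists c : 'I_n.+1 -> int, x = \sum_i e i *~ c i.
  have [c ->] := sgen x; exists (fun i => if unlift ord0 i is Some j then c j else 0).
  rewrite big_ord_recl mul0rz add0r; apply: eq_bigr => i _.
  by rewrite liftK.
have [M MP] := choice (fun i => egen (Phi (e i))).
pose A : 'M[int]_n.+1 := \matrix_(i, j) M i j.
have iterA k i : iter k Phi (e i) = \sum_j e j *~ (A ^+ k) i j.
  elim: k i => [|k IHk] i.
    rewrite (bigD1 i) //= big1 => [|j ji]; first by rewrite expr0 mxE eqxx addr0.
    by rewrite expr0 mxE eq_sym (negbTE ji).
  rewrite iterS IHk raddf_sum exprSr.
  under eq_bigr => l _ do rewrite raddfMz MP mulrz_suml.
  rewrite exchange_big /=; apply: eq_bigr => j _.
  rewrite mxE mulrz_sumr; apply: eq_bigr => l _.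
  by rewrite -mulrzA mxE mulrC.
exists (char_poly A); first exact: char_poly_monic.
move=> x; rewrite poly_act_sum; have [c ->] := egen x.
have Phik k : iter k Phi (\sum_i e i *~ c i) = \sum_i iter k Phi (e i) *~ c i.
  elim: k => [|k IHk] //=; rewrite IHk raddf_sum.
  by apply: eq_bigr => i _; rewrite raddfMz.
under eq_bigr => k _ do rewrite Phik mulrz_suml.
rewrite exchange_big big1 //= => i _.
under eq_bigr => k _ do rewrite mulrzAC iterA.
rewrite -mulrz_suml [X in X *~ _](_ : _ = 0) ?mul0rz //.
under eq_bigr => k _ do rewrite mulrz_suml.
rewrite exchange_big big1 //= => j _.
under eq_bigr => k _ do rewrite -mulrzA.
rewrite -mulrz_sumr [X in _ *~ X](_ : _ = 0) //.
have /matrixP/(_ i j) := Cayley_Hamilton A.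
rewrite -[X in horner_mx A X]coefK poly_def linear_sum summxE [RHS]mxE => CH.
apply: etrans CH.
by apply: eq_bigr => k _; rewrite linearZ rmorphXn /= horner_mx_X mxE mulrC.
Qed.

(** An annihilating polynomial of [Phi] loses its factors [X] by injectivity, so
    one may take its constant coefficient [a] nonzero. Then
    [h' *~ a = - Phi (poly_act c h')] shows that [Phi H] contains [a H]. *)
Lemma finite_cokernel (H : set G) :
  subgroup H -> (forall x, H x -> H (Phi x)) ->
  exists2 P : seq G, forall p, p \in P -> H p &
    forall h, H h -> exists p h', [/\ p \in P, H h' & h = p + Phi h'].
Proof.
move=> sgH HPhi.
have [p pmon pann] := monic_annihilator.
(* Strip the leading zero coefficients of [p], which is nonzero. *)
have [a [c [a0 ann]]] : exists a c, a != 0 /\ forall x, poly_act (a :: c) x = 0.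
  have: has (fun a => a != 0) p.
    apply/hasP; exists (lead_coef p); last by rewrite (eqP pmon).
    by rewrite mem_nth // prednK // lt0n size_poly_eq0 monic_neq0.
  elim: (polyseq p) pann => //= a c IHc ann.
  have [a0|a0] := eqVneq a 0; last by exists a, c.
  move=> /IHc; apply => x; apply: Phi_inj.
  by have := ann x; rewrite a0 mulr0z add0r raddf0.
have Hc x : H x -> H (poly_act c x).
  move=> Hx; elim: c {ann} => [|b c IHc] /=; first exact: sgH.1.
  by apply: subgroupD => //; [exact: subgroupMz|exact: HPhi].
have [s sgen] := fgG.
have Hs : H `<=` zspan s by move=> x _; have [d ->] := sgen x; apply: zspan_sum.
have [P [PH Pcov]] := subgroup_mod_finite a0 sgH Hs.
exists P => // h /Pcov[q [h' [qP Hh' ->]]].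
exists q, (- poly_act c h'); split=> //; first by apply: subgroupN => //; apply: Hc.
by congr (_ + _); rewrite raddfN; apply/eqP; rewrite -addr_eq0; apply/eqP; apply: ann.
Qed.

End FiniteIndex.

(** * Cycles and the theorem *)

(** Grouping the terms [r] by [r] turns a cycle for [F] into a self-similar set
    for the [r]-th power of [F], even if [r] does not divide [d]. *)
Lemma Fcycle_self_similar (G : zmodType) (F : {additive G -> G}) g d r y :
  (0 < r)%N ->
  let c := \sum_(i < r) iter (i * d) F g in
  Fcycle F g d y <->
  y \in [seq \sum_(i < k.+1) iter (i * d) F g | k <- iota 0 r] \/
  exists q z, [/\ q \in [:: c], Fcycle F g d z & y = q + iter d (iter r F) z].
Proof.
move=> r0 c.
have Fsum k n (E : 'I_n -> G) : iter k F (\sum_i E i) = \sum_i iter k F (E i).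
  by elim: k => //= k ->; rewrite raddf_sum.
have shift l : \sum_(i < (r + l).+1) iter (i * d) F g =
    c + iter d (iter r F) (\sum_(i < l.+1) iter (i * d) F g).
  rewrite -addnS big_split_ord /=; congr (_ + _).
  rewrite -iterM Fsum; apply: eq_bigr => i _.
  by rewrite -iterD mulnDl mulnC.
split.
  move=> [l ->]; have [lr|rl] := ltnP l r.
    by left; apply/mapP; exists l; rewrite ?mem_iota.
  right; exists c, (\sum_(i < (l - r).+1) iter (i * d) F g).
  by split; rewrite ?inE //; [exists (l - r)%N|rewrite -shift subnKC].
case=> [/mapP[k _ ->]|]; first by exists k.
by case=> _ [_ [/[!inE]/eqP-> [l ->] ->]]; exists (r + l)%N.
Qed.

Theorem theorem6p9 (G : zmodType) (F : {additive G -> G})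
    (hG : finitely_generated G)
    (hF : injective F)
    (hzd : forall d : nat, (0 < d)%N ->
       ~ zero_divisor (subring_gen F) (fun x => iter d F x - x))
    (hspan : exists (r : nat) (Sigma : {fset G}),
       (0 < r)%N /\ spanning_set (iter r F) Sigma)
    (S : set G) (hS : Fsubset F S) :
  Fautomatic F S.
Proof.
have [r [Sigma [r0 span]]] := hspan.
have addFr : zmod_morphism (iter r F).
  by elim: (r) => [|n IHn] x y //=; rewrite IHn raddfB.
pose Phi : {additive G -> G} :=
  HB.pack (iter r F) (GRing.isZmodMorphism.Build G G (iter r F) addFr).
have Phi_inj : injective Phi.
  by rewrite /=; elim: (r) => [|n IHn] x y //= /hF/IHn.
exists r, Sigma; split=> //; apply: (@recognized_automatic _ Phi).
have [m [n [A [basicA ->]]]] := hS.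
apply: (big_ind (recognized Phi Sigma)) => [|B C|i _].
- exact: recognized0.
- exact: recognizedU.
apply: (big_ind (recognized Phi Sigma)) => [|B C|j _].
- exact: recognized_set1.
- exact: recognized_sumset.
case: (basicA i j (ltn_ord i) (ltn_ord j)) => [g|H sgH HF|g d d0].
- exact: recognized_set1.
- have HPhi x : H x -> H (Phi x).
    by rewrite /=; elim: (r) => [|k IHk] //= Hx; apply: HF; apply: IHk.
  have [P PH Pcov] := finite_cokernel Phi_inj hG sgH HPhi.
  apply: (@recognized_self_similar _ Phi _ Phi_inj span [::] P 1) => // h; split.
    by move=> /Pcov[p [h' [? ? ?]]]; right; exists p, h'.
  case=> // -[p [h' [/PH Hp Hh' ->]]]; apply: subgroupD => //; exact: HPhi.
exact: (recognized_self_similar Phi_inj span d0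
  (fun y => @Fcycle_self_similar G F g d r y r0)).
Qed.
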